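(* Let $n\ge 3$ and $k\ge 3$. There exists a cyclic sequence over $\{0,\dots,k-1\}$ of length $L_k(n)=|\mathbf{S}_k(n)|$ whose length-$n$ windows are exactly the elements of $\mathbf{S}_k(n)$, each occurring exactly once (a universal cycle for $\mathbf{S}_k(n)$); this sequence is an orientable sequence of order $n$.
   Context: Let $\Sigma=\{0,1,\dots,k-1\}$. Strings are compared lexicographically ($\alpha<\beta$ if $\alpha$ is a proper prefix of $\beta$, or $\alpha$ has the smaller symbol at the first index where they differ). For $\alpha=a_1\cdots a_n$, $\alpha^R=a_n\cdots a_1$; $[\alpha]$ is the set of rotations of $\alpha$. $\alpha$ is a necklace if it is the lexicographically smallest element of $[\alpha]$; a bracelet if it is the lexicographically smallest element of $[\alpha]\cup[\alpha^R]$. A necklace $\alpha$ is symmetric if $\alpha^R\in[\alpha]$, asymmetric otherwise. $\mathbf{A}_k(n)$ is the set of asymmetric bracelets of length $n$ over $\Sigma$, and $\mathbf{S}_k(n)=\bigcup_{\alpha\in\mathbf{A}_k(n)}[\alpha]$. A cyclic sequence $s_1\cdots s_L$ has windows $w_t=s_t\cdots s_{t+n-1}$ ($t=1,\dots,L$, indices mod $L$); it is an orientable sequence of order $n$ if the $2L$ strings $w_1,\dots,w_L,w_1^R,\dots,w_L^R$ are pairwise distinct. *)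

(* Defs.v *)
From mathcomp Require Import all_boot.
Set Implicit Arguments. Unset Strict Implicit. Unset Printing Implicit Defensive.

(* Strings over Sigma = {0,...,k-1} are represented as [seq nat] whose
   entries are all < k. *)

Fixpoint lexle (a b : seq nat) : bool :=
  match a, b with
  | [::], _ => true
  | _ :: _, [::] => false
  | x :: a', y :: b' => (x < y) || ((x == y) && lexle a' b')
  end.

Definition rotations (a : seq nat) : seq (seq nat) :=
  [seq rot i a | i <- iota 0 (size a)].

Definition is_necklace (a : seq nat) : bool :=
  all (lexle a) (rotations a).

Definition is_bracelet (a : seq nat) : bool :=
  all (lexle a) (rotations a ++ rotations (rev a)).

Definition is_symmetric (a : seq nat) : bool := rev a \in rotations a.

Fixpoint all_strings (k n : nat) : seq (seq nat) :=
  match n with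
  | 0 => [:: [::]]
  | n'.+1 => [seq x :: w | x <- iota 0 k, w <- all_strings k n']
  end.

Definition in_A (k n : nat) (a : seq nat) : bool :=
  [&& size a == n, all (fun x => x < k) a, is_necklace a, is_bracelet a
    & ~~ is_symmetric a].

Definition S_list (k n : nat) : seq (seq nat) :=
  [seq w <- all_strings k n |
     has (fun a => in_A k n a && (w \in rotations a)) (all_strings k n)].

Definition L (k n : nat) : nat := size (S_list k n).

Definition window (n : nat) (s : seq nat) (t : nat) : seq nat :=
  [seq nth 0 s ((t + j) %% size s) | j <- iota 0 n].

Definition windows (n : nat) (s : seq nat) : seq (seq nat) :=
  [seq window n s t | t <- iota 0 (size s)].

Definition orientable (n : nat) (s : seq nat) : bool :=
  uniq (windows n s ++ map rev (windows n s)).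

(* Main.v *)
Require Import Defs.
From mathcomp Require Import all_boot all_order all_fingroup zify.
Import Order.Theory DefaultSeqLexiOrder.

Set Implicit Arguments.
Unset Strict Implicit.
Unset Printing Implicit Defensive.

(** A permutation of a rotation-closed set of words that maps every word to one
    overlapping it still does so after composition with the transposition of
    [x :: w] and [y :: w], which joins the orbits of these two words when they
    differ. With the fewest possible orbits, words that can be reached from one
    another by rotations and changes of the first symbol share an orbit. If this
    is true of all words, reading the single orbit gives a universal cycle.

    Connectivity of the rotations of asymmetric bracelets: put [m := k - 1].
    Lowering the first symbol to [0] preserves asymmetric bracelets. Write one
    that starts with [0] as [0 :: u ++ s :: m^c] with [s < m]. Raising [s] to
    [m - 1], or from [m - 1] to [m], gives an asymmetric bracelet again, unless
    [s = m - 1] and [0 :: u = p ++ m^j] with [p] a palindrome and [j < c]. In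
    that case the final [0] of [p] can be raised to [1], if [p] is not just [0].
    As the sum of the symbols grows, this ends with [0 m^j (m-1) m^c], which is
    two changes away from [0 (m-1) m^(n-2)]. *)

(** * Lexicographic order *)

Section LexicographicOrder.

Context {disp : Order.disp_t} {T : orderType disp}.
Implicit Types (x y s m : T) (a b u v w : seq T) (j c : nat).

Lemma ltxi_head x y a b : (x < y)%O -> (x :: a < y :: b)%O.
Proof. by move=> xy; rewrite neqhead_ltxiE ?lt_eqF. Qed.

Lemma ltxi_cat a b u v : size a = size b ->
  (a ++ u < b ++ v)%O = (a < b)%O || ((a == b) && (u < v)%O).
Proof.
elim: a b => [|x a IH] [|y b] //= [eq_sz]; rewrite !ltxi_cons IH // eqseq_cons.
by case: (ltgtP x y).
Qed.

Lemma ltxi_cat2l a u v : (a ++ u < a ++ v)%O = (u < v)%O.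
Proof. by elim: a => //= x a; rewrite eqhead_ltxiE. Qed.

Lemma lexi_cat2l a u v : (a ++ u <= a ++ v)%O = (u <= v)%O.
Proof. by elim: a => //= x a; rewrite eqhead_lexiE. Qed.

Lemma lexi_raise s s' a b u v : (s < s')%O -> size b <= size a ->
  (a ++ s :: u <= b ++ s :: v)%O -> (a ++ s' :: u <= b ++ s' :: v)%O.
Proof.
move=> ss'; elim: b a => [|y b IH] [|x a] //= sz; rewrite ?eqhead_lexiE //.
  by move=> /lexi_lehead xs; apply/ltW/ltxi_head/(le_lt_trans xs).
by rewrite !lexi_cons; case: (ltgtP x y) => //= _; apply: IH.
Qed.

Lemma ltxi_raise s s' a b u v : (s < s')%O -> size b <= size a ->
  (a ++ s :: u < b ++ s :: v)%O -> (a ++ s' :: u < b ++ s' :: v)%O.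
Proof.
move=> ss'; elim: b a => [|y b IH] [|x a] //= sz; rewrite ?eqhead_ltxiE //.
  by move=> /ltxi_lehead xs; apply/ltxi_head/(le_lt_trans xs).
by rewrite !ltxi_cons; case: (ltgtP x y) => //= _; apply: IH.
Qed.

Lemma ltxi_nseq_cat m j c x a b : (x < m)%O -> j < c ->
  (nseq j m ++ x :: a < nseq c m ++ b)%O.
Proof.
move=> xm; elim: j c => [|j IH] [|c] //= jc; first exact: ltxi_head.
by rewrite eqhead_ltxiE IH.
Qed.

Lemma lexi_nseq_cat m c w x a b : all (fun y => y <= m)%O w ->
  (nseq c m ++ a <= w ++ x :: b)%O ->
  prefix (nseq c m) w \/ [/\ size w < c, w = nseq (size w) m & (m <= x)%O].
Proof.
elim: c w => [|c IH] [|y w] //=; try by left.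
- by move=> _ /lexi_lehead; right.
- case/andP=> ym w_le; rewrite lexi_cons ym => /andP[my].
  have -> : y = m by apply/le_anti/andP.
  rewrite eqxx => /(IH _ w_le)[wc|[wc ew mx]]; [by left|right].
  by rewrite -ew.
Qed.

Lemma lexi_nseq_prefix m c w x a b : all (fun y => y <= m)%O w -> (x < m)%O ->
  (nseq c m ++ a <= w ++ x :: b)%O -> exists w', w = nseq c m ++ w'.
Proof.
move=> w_le xm /(lexi_nseq_cat w_le)[/prefixP//|[_ _]].
by rewrite leNgt xm.
Qed.

End LexicographicOrder.

(** * Rotations and asymmetric bracelets *)

Lemma lexleE : lexle =2 <=%O.
Proof.
elim=> [|x a IH] [|y b] //=.
by rewrite lexi_cons !leEnat IH; case: ltngtP.
Qed.

Lemma rotationsP a w :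
  reflect (exists p y q, a = p ++ y :: q /\ w = y :: q ++ p)
          (w \in rotations a).
Proof.
apply: (iffP mapP) => [[i]|[p [y [q [-> ->]]]]].
  rewrite mem_iota => i_lt ->; exists (take i a), (nth 0 a i), (drop i.+1 a).
  by rewrite -cat_cons -drop_nth // cat_take_drop.
exists (size p); last by rewrite rot_size_cat.
by rewrite mem_iota size_cat /=; lia.
Qed.

Lemma mem_rotations_rot i w a : (rot i w \in rotations a) = (w \in rotations a).
Proof.
suff rotI j v : v \in rotations a -> rot j v \in rotations a.
  apply/idP/idP => [/(rotI (size (rot i w) - i))|/rotI//].
  by rewrite -/(rotr i _) rotK.
case/mapP=> l; rewrite mem_iota /= => l_lt ->; rewrite rot_rot_add.
set l' := rot_add a l j; have [l'_lt|l'_ge] := ltnP l' (size a).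
  by apply/mapP; exists l'; rewrite ?mem_iota.
rewrite rot_oversize //; apply/mapP; exists 0; rewrite ?rot0 // mem_iota; lia.
Qed.

Lemma mem_rotations_self a : a != [::] -> a \in rotations a.
Proof.
by case: a => // x a _; apply/mapP; exists 0; rewrite ?rot0 ?mem_iota.
Qed.

Lemma rotations_sym a b : (a \in rotations b) = (b \in rotations a).
Proof.
suff sym u v : u \in rotations v -> v \in rotations u.
  by apply/idP/idP; apply: sym.
case/rotationsP=> p [y [q [-> ->]]].
rewrite -[p ++ _](rot_size_cat (y :: q)) mem_rotations_rot.
exact: mem_rotations_self.
Qed.

Lemma rotations_trans a b c :
  a \in rotations b -> b \in rotations c -> a \in rotations c.
Proof. by case/mapP=> i _ ->; rewrite mem_rotations_rot. Qed.

Lemma rotations_rev a b : (rev a \in rotations (rev b)) = (a \in rotations b).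
Proof.
suff revI u v : u \in rotations v -> rev u \in rotations (rev v).
  by apply/idP/idP => [/revI|/revI//]; rewrite !revK.
case/rotationsP=> p [y [q [-> ->]]]; rewrite -cat_cons !rev_cat.
rewrite -[rev p ++ _](rot_size_cat (rev (y :: q))) mem_rotations_rot.
by apply: mem_rotations_self; rewrite -size_eq0 size_cat size_rev.
Qed.

Lemma rotations_revP a w :
  reflect (exists p y q, a = p ++ y :: q /\ w = y :: rev p ++ rev q)
          (w \in rotations (rev a)).
Proof.
apply: (iffP (rotationsP _ _)) => [[p [y [q [ra ->]]]]|[p [y [q [-> ->]]]]].
  exists (rev q), y, (rev p); rewrite !revK; split=> //.
  by rewrite -(revK a) ra rev_cat rev_cons cat_rcons.
by exists (rev q), y, (rev p); rewrite rev_cat rev_cons cat_rcons.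
Qed.

Lemma is_necklaceP a :
  reflect (forall p y q, a = p ++ y :: q -> (a <= y :: q ++ p)%O)
          (is_necklace a).
Proof.
apply: (iffP allP) => [min_a p y q ea|min_a w /rotationsP[p [y [q [ea ->]]]]].
  by rewrite -lexleE min_a //; apply/rotationsP; exists p, y, q.
by rewrite lexleE; apply: min_a.
Qed.

Definition asym_bracelet (a : seq nat) : bool :=
  is_necklace a && all (fun w => (a < w)%O) (rotations (rev a)).

Lemma in_AE k n a :
  in_A k n a = [&& size a == n, all (fun x => x < k) a & asym_bracelet a].
Proof.
rewrite /in_A /asym_bracelet; do 2 congr andb.
rewrite /is_bracelet all_cat -/(is_necklace a); case: (is_necklace a) => //=.
rewrite /is_symmetric -rotations_rev revK -has_pred1 -all_predC -all_predI.
by apply: eq_all => w /=; rewrite lexleE lt_neqAle eq_sym andbC.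
Qed.

Lemma asym_bracelet_lt_rev a p y q :
  asym_bracelet a -> a = p ++ y :: q -> (a < y :: rev p ++ rev q)%O.
Proof.
by case/andP=> _ /allP lt_a ea; apply/lt_a/rotations_revP; exists p, y, q.
Qed.

(** * The set of rotations of asymmetric bracelets *)

Lemma mem_all_strings k n w :
  (w \in all_strings k n) = (size w == n) && all (fun x => x < k) w.
Proof.
elim: n w => [|n IH] [|x w] /=; rewrite ?inE //.
  by apply/allpairsPdep => -[y [v [_ _]]].
apply/allpairsPdep/idP => [[y [v [y_in v_in [-> ->]]]]|/and3P[w_size xk wk]].
  by move: v_in y_in; rewrite IH mem_iota /= eqSS => /andP[-> ->] ->.
by exists x, w; rewrite mem_iota IH -eqSS w_size.
Qed.

Lemma all_strings_uniq k n : uniq (all_strings k n).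
Proof.
elim: n => //= n IH; apply: allpairs_uniq; rewrite ?iota_uniq //.
by move=> [x v] [y w] _ _ /= [-> ->].
Qed.

Lemma S_list_uniq k n : uniq (S_list k n).
Proof. exact/filter_uniq/all_strings_uniq. Qed.

Section SList.

Variables k n : nat.
Implicit Types (a w : seq nat) (i : nat).

Lemma S_list_word w : w \in S_list k n -> size w = n /\ all (fun x => x < k) w.
Proof. by rewrite mem_filter mem_all_strings => /and3P[_ /eqP]. Qed.

Lemma S_listP w :
  reflect (exists2 a, in_A k n a & w \in rotations a) (w \in S_list k n).
Proof.
rewrite mem_filter mem_all_strings.
apply: (iffP andP) => [[/hasP[a _ /andP[]]]|[a a_in w_rot]]; first by exists a.
have := a_in; rewrite in_AE => /and3P[a_size ak _]; split.
  by apply/hasP; exists a; rewrite ?a_in // mem_all_strings a_size.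
by case/mapP: w_rot => i _ ->; rewrite size_rot a_size (eq_all_r (mem_rot i a)).
Qed.

Lemma S_list_rot i w : w \in S_list k n -> rot i w \in S_list k n.
Proof.
case/S_listP=> a a_in w_rot; apply/S_listP; exists a => //.
by rewrite mem_rotations_rot.
Qed.

Lemma in_A_S_list a : 0 < n -> in_A k n a -> a \in S_list k n.
Proof.
move=> n_gt0 a_in; apply/S_listP; exists a => //; apply: mem_rotations_self.
by move: a_in; rewrite in_AE -size_eq0 => /and3P[/eqP-> _ _]; rewrite -lt0n.
Qed.

Lemma rev_notin_S_list w : w \in S_list k n -> rev w \notin S_list k n.
Proof.
case/S_listP=> a; rewrite in_AE => /and3P[_ _ /andP[_ /allP lt_a]] w_rot_a.
apply/negP => /S_listP[b]; rewrite in_AE => /and3P[_ _ /andP[_ /allP lt_b]].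
rewrite rotations_sym => b_rot_w.
have b_rot_a : b \in rotations (rev a).
  by apply: rotations_trans b_rot_w _; rewrite rotations_rev.
have a_rot_b : a \in rotations (rev b).
  by rewrite -rotations_rev revK rotations_sym.
by have := lt_trans (lt_a b b_rot_a) (lt_b a a_rot_b); rewrite ltxx.
Qed.

End SList.

(** * Cycle joining *)

Lemma joined_porbits_exists (T : finType) (P : pred {perm T}) (e : rel T) f0 :
  P f0 -> (forall f x y, P f -> e x y -> P (tperm x y * f)%g) ->
  exists2 f, P f & forall x y, e x y -> porbit f x = porbit f y.
Proof.
move=> Pf0 P_tperm.
case: (@arg_minnP _ f0 P (fun f => #|porbits f|) Pf0) => f Pf f_min.
exists f => // x y exy; apply/eqP; rewrite eq_porbit_mem.
apply/negPn/negP => x_notin.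
have neq_xy : x != y by apply: contraNneq x_notin => ->; apply: porbit_id.
have := f_min _ (P_tperm f x y Pf exy); have := porbits_mul_tperm f x y.
by rewrite /= x_notin neq_xy addn1 addn2 => -[<-]; rewrite ltnn.
Qed.

Lemma iter_modn_porbit (T : finType) (f : {perm T}) x i :
  iter (i %% #|porbit f x|) f x = iter i f x.
Proof.
rewrite [in RHS](divn_eq i #|porbit f x|) addnC iterD iterM.
by rewrite [iter (_ %/ _) _ x]iter_fix ?iter_porbit.
Qed.

Inductive reachable (A : eqType) (V : seq (seq A)) (r : seq A) :
  seq A -> Prop :=
| reachable_refl : reachable V r r
| reachable_rot i w : reachable V r w -> reachable V r (rot i w)
| reachable_head x y w : x :: w \in V -> y :: w \in V ->
    reachable V r (x :: w) -> reachable V r (y :: w).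

Lemma take_pred_rot1 (A : Type) (w : seq A) :
  take (size w).-1 (rot 1 w) = behead w.
Proof. by case: w => // x w; rewrite rot1_cons -cats1 take_size_cat. Qed.

Section OverlapPermutations.

Variables (A : choiceType) (V : seq (seq A)) (n : nat).
Hypothesis V_size : {in V, forall w, size w = n}.
Hypothesis V_rot : forall i w, w \in V -> rot i w \in V.

Local Notation T := (seq_sub V).
Implicit Types (f : {perm T}) (r x y z : T).

Definition overlapping f : bool :=
  [forall x, take n.-1 (val (f x)) == behead (val x)].

Lemma size_seq_sub x : size (val x) = n.
Proof. exact/V_size/ssvalP. Qed.

Lemma overlapping_exists : exists f, overlapping f.
Proof.
pose g x : T := insubd x (rot 1 (val x)).
have val_g x : val (g x) = rot 1 (val x) by rewrite val_insubd V_rot // ssvalP.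
have g_inj : injective g.
  by move=> x y /(congr1 val); rewrite !val_g => /rot_inj /val_inj.
exists (perm g_inj); apply/forallP => x.
by rewrite permE val_g -(size_seq_sub x) take_pred_rot1.
Qed.

Lemma overlapping_tperm f x y :
  overlapping f -> behead (val x) == behead (val y) ->
  overlapping (tperm x y * f)%g.
Proof.
move=> /forallP f_overlap /eqP eq_xy; apply/forallP => z.
by rewrite permM (eqP (f_overlap _)); case: tpermP => // ->; rewrite eq_xy.
Qed.

Lemma overlapping_cycle_exists r : {in V, forall w, reachable V (val r) w} ->
  exists2 f, overlapping f & forall x, x \in porbit f r.
Proof.
move=> V_reachable; have [f0 f0_overlap] := overlapping_exists.
have [f f_overlap f_joined] :=
  joined_porbits_exists f0_overlap overlapping_tperm.
exists f => // x; rewrite -eq_porbit_mem; apply/eqP.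
have porbit_rot1 y z : val z = rot 1 (val y) -> porbit f z = porbit f y.
  move=> ez; rewrite -(permKV f z) -{2}[f]expg1 porbit_perm; apply/f_joined.
  rewrite -(eqP (forallP f_overlap _)) permKV ez -(size_seq_sub y).
  by rewrite take_pred_rot1.
have porbit_rot i y z : val z = rot i (val y) -> porbit f z = porbit f y.
  elim: i z => [|i IH] z; first by rewrite rot0 => /val_inj->.
  case: (ltnP i (size (val y))) => [i_lt|i_ge]; last first.
    by rewrite rot_oversize => [/val_inj->|]; last exact: leqW.
  rewrite rotS // => ez; pose u : T := SeqSub (V_rot i (ssvalP y)).
  by rewrite (@porbit_rot1 u) // IH.
suff [y /val_inj<-] : exists2 y, val y = val x & porbit f y = porbit f r by [].
elim: (V_reachable (val x) (ssvalP x)) =>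
    {x} [|i w _ [y <- <-]|a b w _ bw_in _ [y ey <-]].
- by exists r.
- by exists (SeqSub (V_rot i (ssvalP y))); rewrite // (@porbit_rot i y).
- by exists (SeqSub bw_in) => //; apply: f_joined; rewrite ey.
Qed.

Lemma head_iter_overlapping a0 f x j : overlapping f -> j < n ->
  head a0 (val (iter j f x)) = nth a0 (val x) j.
Proof.
move=> /forallP f_overlap; elim: j x => [|j IH] x j_lt; first by rewrite nth0.
rewrite iterSr IH 1?ltnW // -nth_behead -(eqP (f_overlap x)) nth_take //; lia.
Qed.

End OverlapPermutations.

Lemma size_window n s t : size (window n s t) = n.
Proof. by rewrite size_map size_iota. Qed.

Lemma nth_window n s t j :
  j < n -> nth 0 (window n s t) j = nth 0 s ((t + j) %% size s).
Proof. by move=> j_lt; rewrite (nth_map 0) ?size_iota // nth_iota. Qed.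

Lemma size_windows n s : size (windows n s) = size s.
Proof. by rewrite size_map size_iota. Qed.

Lemma nth_windows n s t :
  t < size s -> nth [::] (windows n s) t = window n s t.
Proof. by move=> t_lt; rewrite (nth_map 0) ?size_iota // nth_iota. Qed.

Lemma all_windows (p : pred nat) n s :
  0 < n -> all (all p) (windows n s) -> all p s.
Proof.
move=> n_gt0 /(all_nthP [::]) pw; apply/(all_nthP 0) => t t_lt.
have := pw t; rewrite size_windows nth_windows // => /(_ t_lt).
move=> /(all_nthP 0)/(_ 0).
by rewrite size_window nth_window // addn0 modn_small //; apply.
Qed.

Section UniversalCycles.

Variables (n : nat) (V : seq (seq nat)).
Hypothesis V_size : {in V, forall w, size w = n}.

Definition porbit_heads (f : {perm seq_sub V}) r : seq nat :=
  [seq head 0 (val x) | x <- traject f r #|porbit f r|].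

Lemma windows_porbit_heads f r : overlapping n f ->
  windows n (porbit_heads f r) = [seq val x | x <- traject f r #|porbit f r|].
Proof.
move=> f_overlap; have sz : size (porbit_heads f r) = #|porbit f r|.
  by rewrite size_map size_traject.
have orbit_gt0 : 0 < #|porbit f r| by rewrite lt0n card_porbit_neq0.
apply: (@eq_from_nth _ [::]).
  by rewrite size_windows sz size_map size_traject.
move=> t; rewrite size_windows => t_lt; rewrite nth_windows //.
rewrite (nth_map r) ?size_traject -?sz // nth_traject -?sz //.
apply: (@eq_from_nth _ 0); rewrite size_window ?(size_seq_sub V_size) //.
move=> j j_lt.
rewrite nth_window // sz (nth_map r) ?size_traject ?ltn_mod //.
rewrite nth_traject ?ltn_mod // iter_modn_porbit addnC iterD.
exact: head_iter_overlapping f_overlap j_lt.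
Qed.

Lemma universal_cycle_exists r : uniq V -> r \in V ->
  (forall i w, w \in V -> rot i w \in V) ->
  {in V, forall w, reachable V r w} ->
  exists s, perm_eq (windows n s) V.
Proof.
move=> V_uniq r_in V_rot V_reachable; pose r' : seq_sub V := SeqSub r_in.
have [f f_overlap f_cycle] :=
  overlapping_cycle_exists (r := r') V_size V_rot V_reachable.
exists (porbit_heads f r'); rewrite windows_porbit_heads //.
apply: uniq_perm => //.
  by rewrite map_inj_uniq ?uniq_traject_porbit //; apply: val_inj.
move=> w; apply/mapP/idP => [[x _ ->]|w_in]; first exact: ssvalP.
by exists (SeqSub w_in); rewrite // -porbit_traject.
Qed.

End UniversalCycles.

Lemma orientable_perm n s (V : seq (seq nat)) :
  uniq V -> perm_eq (windows n s) V ->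
  {in V, forall w, rev w \notin V} -> orientable n s.
Proof.
move=> V_uniq sV V_rev; rewrite /orientable cat_uniq (perm_uniq sV) V_uniq.
rewrite map_inj_uniq ?(perm_uniq sV) ?V_uniq ?andbT; last exact: can_inj revK.
apply/hasPn => _ /mapP[w w_in ->].
by rewrite (perm_mem sV) V_rev // -(perm_mem sV).
Qed.

(** * Raising a symbol of an asymmetric bracelet *)

Lemma cat_eq_cat_cons (T : eqType) (u v p q : seq T) y : u ++ v = p ++ y :: q ->
  (exists2 w, u = p ++ y :: w & q = w ++ v) \/ y \in v.
Proof.
elim: u p => [|z u IH] [|z' p] /=.
- by move=> ->; right; apply: mem_head.
- by move=> ->; right; rewrite -cat_cons mem_cat mem_head orbT.
- by case=> -> <-; left; exists u.
- by case=> <- /IH[[w -> ->]|]; [left; exists w|right].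
Qed.

Lemma neq_last_split (T : eqType) (m : T) w : w != nseq (size w) m ->
  exists u s c, s != m /\ w = u ++ s :: nseq c m.
Proof.
elim/last_ind: w => [|w x IH]; rewrite ?eqxx // size_rcons => w_neq.
have [ex|xm] := eqVneq x m; last by exists w, x, 0; rewrite cats1.
have /IH[u [s [c [sm ->]]]] : w != nseq (size w) m.
  by apply: contraNneq w_neq => ->; rewrite size_nseq ex -addn1 nseqD cats1.
by exists u, s, c.+1; rewrite ex rcons_cat rcons_cons -cats1 -(nseqD c 1) addn1.
Qed.

Lemma is_necklace_raise x u s s' v : s < s' -> all (fun y => x < y) (s' :: v) ->
  is_necklace (x :: u ++ s :: v) -> is_necklace (x :: u ++ s' :: v).
Proof.
move=> ss' v_gt /is_necklaceP min_s; apply/is_necklaceP => p y q.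
rewrite -cat_cons => e.
have [[w ew ->]|/(allP v_gt) xy] := cat_eq_cat_cons e; last exact/ltW/ltxi_head.
have rotE z : y :: (w ++ z :: v) ++ p = (y :: w) ++ z :: v ++ p.
  by rewrite /= -catA.
have := min_s p y (w ++ s :: v).
rewrite !rotE -!cat_cons ew -catA => /(_ erefl).
by rewrite catA; apply: lexi_raise; rewrite // size_cat leq_addl.
Qed.

Lemma asym_bracelet_raise_failure x u s s' v :
  s < s' -> all (fun y => x < y) (s' :: v) ->
  asym_bracelet (x :: u ++ s :: v) -> ~~ asym_bracelet (x :: u ++ s' :: v) ->
  exists p w, [/\ u = p ++ w, rev (x :: p) = x :: p, size w < size v,
    (w ++ s :: v < rev v ++ s :: rev w)%O &
    (rev v ++ s' :: rev w <= w ++ s' :: v)%O].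
Proof.
move=> ss' v_gt asym_s; have [nec_s _] := andP asym_s.
rewrite /asym_bracelet (is_necklace_raise ss' v_gt nec_s).
case/allPn=> _ /rotations_revP[p [y [q [e ->]]]]; rewrite -leNgt.
case: (cat_eq_cat_cons (e : (x :: u) ++ _ = _)) =>
    [[w ew ->]|/(allP v_gt) xy]; last first.
  by rewrite leNgt ltxi_head.
have [p' ep] : exists p', rcons p y = x :: p'.
  by case: (p) ew => [|_ p'] [<- _]; [exists [::]|exists (rcons p' y)].
have eu : u = p' ++ w by move: ew; rewrite -cat_rcons ep => -[].
have rev_p : y :: rev p = rev (x :: p') by rewrite -ep rev_rcons.
have revE z : rev (w ++ z :: v) = rev v ++ z :: rev w.
  by rewrite rev_cat rev_cons cat_rcons.
have splitE z : x :: u ++ z :: v = (x :: p') ++ w ++ z :: v.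
  by rewrite eu /= -catA.
rewrite -cat_cons rev_p revE splitE leNgt.
have := asym_bracelet_lt_rev (p := p) (y := y) (q := w ++ s :: v) asym_s.
rewrite -[y :: _ ++ _]cat_cons rev_p revE splitE -ep cat_rcons => /(_ erefl).
rewrite -cat_rcons ep !(ltxi_cat (a := x :: p')) ?size_rev // negb_or.
case/orP=> [->//|/andP[/eqP pal lt_s]]; rewrite -pal ltxx eqxx /= => ge_s'.
exists p', w; split=> //; last by rewrite leNgt.
rewrite ltnNge; apply: contra ge_s' => vw.
by apply: ltxi_raise lt_s; rewrite ?size_rev.
Qed.

Lemma asym_bracelet_cons x w :
  all (fun y => x < y) w -> (w < rev w)%O -> asym_bracelet (x :: w).
Proof.
move=> w_gt lt_w; apply/andP; split.
  apply/is_necklaceP => -[|x' p] y q [ex ew]; first by rewrite ex ew cats0.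
  by apply/ltW/ltxi_head/(allP w_gt); rewrite ew mem_cat mem_head orbT.
apply/allP => _ /rotations_revP[[|x' p] [y [q [[ex ew] ->]]]].
  by rewrite -ex -ew eqhead_ltxiE.
by apply/ltxi_head/(allP w_gt); rewrite ew mem_cat mem_head orbT.
Qed.

Lemma asym_bracelet_lower_head x y w :
  x < y -> asym_bracelet (y :: w) -> asym_bracelet (x :: w).
Proof.
move=> xy asym_y; apply: asym_bracelet_cons.
  apply/allP => z /splitPr zw; case: zw asym_y => p q.
  case/andP=> /is_necklaceP min_y _.
  exact/(leq_trans xy)/(lexi_lehead (min_y (y :: p) z q _)).
by have := asym_bracelet_lt_rev (p := [::]) asym_y erefl; rewrite eqhead_ltxiE.
Qed.

Section RaiseWithMaximalSymbols.

Variables (m x : nat) (u : seq nat).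
Hypothesis u_le : all (fun y => y <= m) u.

Lemma asym_bracelet_raise_last s s' c : x < m -> x < s' -> s < s' -> s' <= m ->
  asym_bracelet (x :: u ++ s :: nseq c m) ->
  ~~ asym_bracelet (x :: u ++ s' :: nseq c m) ->
  s' = m /\ exists p j, [/\ j < c, u = p ++ nseq j m & rev (x :: p) = x :: p].
Proof.
move=> xm xs' ss' s'm asym_s.
have v_gt : all (fun y => x < y) (s' :: nseq c m).
  by rewrite /= xs' all_nseq xm orbT.
case/(asym_bracelet_raise_failure ss' v_gt asym_s) => p [w [eu pal]].
rewrite rev_nseq size_nseq => wc _.
have w_le : all (fun y => y <= m) w.
  by move: u_le; rewrite eu all_cat => /andP[].
case/(lexi_nseq_cat w_le) => [/prefixP[w' ew]|[_ ew ms']].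
  by move: wc; rewrite ew size_cat size_nseq ltnNge leq_addr.
split; first by apply/anti_leq/andP.
by exists p, (size w); rewrite -ew.
Qed.

(* Reading the outer palindrome backwards, the word starts with
   [x :: nseq c m], but its rotation [x :: nseq j m ++ s :: _] is smaller. *)
Lemma not_is_necklace_palindrome p v j s c : s < m -> j < c ->
  u = p ++ nseq c m -> rev (rcons (x :: u) x) = rcons (x :: u) x ->
  ~~ is_necklace (x :: u ++ x :: nseq j m ++ s :: v).
Proof.
move=> sm jc eu pal; apply/negP => /is_necklaceP min_x.
have := min_x (x :: u) x (nseq j m ++ s :: v) erefl.
have -> : x :: u ++ x :: nseq j m ++ s :: v =
    x :: nseq c m ++ rev (x :: p) ++ nseq j m ++ s :: v.
  rewrite -cat_cons -cat_rcons -pal eu rev_rcons -cat_cons rev_cat.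
  by rewrite rev_nseq /= -catA.
by rewrite eqhead_lexiE -catA leNgt ltxi_nseq_cat.
Qed.

Lemma asym_bracelet_raise_palindrome y j s c :
  x < y -> y < m -> x < s -> s < m -> j < c ->
  rev (rcons (x :: u) x) = rcons (x :: u) x ->
  asym_bracelet (x :: u ++ x :: nseq j m ++ s :: nseq c m) ->
  asym_bracelet (x :: u ++ y :: nseq j m ++ s :: nseq c m).
Proof.
move=> xy ym xs sm jc pal asym_x; have xm := ltn_trans xy ym.
set v := nseq j m ++ s :: nseq c m in asym_x *.
have v_gt : all (fun z => x < z) (y :: v).
  by rewrite /= xy all_cat /= xs !all_nseq xm !orbT.
apply: contraT => /(asym_bracelet_raise_failure xy v_gt asym_x).
case=> p [w [eu pal_p wv]].
have -> : rev v = nseq c m ++ s :: nseq j m.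
  by rewrite rev_cat rev_cons !rev_nseq cat_rcons.
have w_le : all (fun y => y <= m) w.
  by move: u_le; rewrite eu all_cat => /andP[].
rewrite -!catA => lt_x le_y.
have [w' ew] := lexi_nseq_prefix w_le ym le_y.
rewrite ew in le_y lt_x wv w_le *.
move: lt_x le_y; rewrite -!catA ltxi_cat2l lexi_cat2l.
case: w' ew w_le wv => [|h w'] ew w_le wv.
  have /andP[nec_x _] := asym_x; rewrite ew cats0 in eu.
  by case/negP: (not_is_necklace_palindrome (nseq c m) sm jc eu pal).
move=> /ltxi_lehead hs le_y.
have eh : h = s by apply/le_anti; rewrite hs (lexi_lehead le_y).
move: le_y; rewrite eh eqhead_lexiE => /(@lexi_nseq_prefix _ _ m j w' y)[] //.
  by move: w_le; rewrite all_cat => /and3P[].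
by move=> g eg; move: wv; rewrite eg /v !size_cat /= !size_cat !size_nseq; lia.
Qed.

End RaiseWithMaximalSymbols.

Lemma asym_bracelet_raisable m x w :
  x < m.-1 -> all (fun z => z <= m) w -> asym_bracelet (x :: w) ->
  (exists j c, j < c /\ w = nseq j m ++ m.-1 :: nseq c m) \/
  (exists p y z q,
     [/\ w = p ++ y :: q, y < z <= m & asym_bracelet (x :: p ++ z :: q)]).
Proof.
move=> xm w_le asym_w; have w_neq : w != nseq (size w) m.
  apply/eqP => ew; have := asym_bracelet_lt_rev (p := [::]) asym_w erefl.
  by rewrite ew rev_nseq ltxx.
have [u [s [c [sm ew]]]] := neq_last_split w_neq.
rewrite {}ew in w_le asym_w *; move: w_le.
rewrite all_cat => /and3P[u_le s_le _].
have [s_lt|s_ge] := ltnP s m.-1.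
  right; exists u, s, m.-1, (nseq c m); split; rewrite ?s_lt ?leq_pred //.
  apply: contraT => /(asym_bracelet_raise_last u_le _ _ s_lt _ asym_w)[]; lia.
have es : s = m.-1 by lia.
have [asym_m|] := boolP (asym_bracelet (x :: u ++ m :: nseq c m)).
  by right; exists u, s, m, (nseq c m); split=> //; lia.
case/(asym_bracelet_raise_last u_le _ _ _ _ asym_w); try lia.
move=> _ [p [j [jc eu]]]; case/lastP: p eu => [|p z] eu pal.
  by left; exists j, c; rewrite eu es.
have ez : z = x by move: pal; rewrite -rcons_cons rev_rcons => -[].
rewrite {}ez in eu pal.
have ew : u ++ s :: nseq c m = p ++ x :: nseq j m ++ s :: nseq c m.
  by rewrite eu cat_rcons -catA.
rewrite ew in asym_w *; right; exists p, x, x.+1, (nseq j m ++ s :: nseq c m).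
split=> //; first by lia.
apply: asym_bracelet_raise_palindrome asym_w => //; try lia.
by move: u_le; rewrite eu all_cat all_rcons => /andP[/andP[]].
Qed.

(** * Connectivity *)

Lemma reachable_change (A : eqType) (V : seq (seq A)) r p x y q :
  (forall i w, w \in V -> rot i w \in V) ->
  p ++ x :: q \in V -> p ++ y :: q \in V ->
  reachable V r (p ++ x :: q) -> reachable V r (p ++ y :: q).
Proof.
move=> V_rot /(V_rot (size p)) x_in /(V_rot (size p)) y_in.
move/(reachable_rot (size p)); rewrite !rot_size_cat in x_in y_in * => x_reach.
rewrite -(rot_size_cat (y :: q)); apply: reachable_rot.
exact: (reachable_head (x := x)).
Qed.

Section Connectivity.

Variables n m : nat.
Hypotheses (n_gt2 : 2 < n) (m_gt1 : 1 < m).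

Local Notation A := (in_A m.+1 n).

Definition root_bracelet := 0 :: m.-1 :: nseq n.-2 m.

Local Notation R := (reachable (S_list m.+1 n) root_bracelet).

Lemma in_A_change p x y q : A (p ++ x :: q) -> y <= m ->
  asym_bracelet (p ++ y :: q) -> A (p ++ y :: q).
Proof.
rewrite !in_AE !size_cat !all_cat /= !ltnS.
by case/and3P=> -> /and3P[-> _ ->] _ -> ->.
Qed.

Lemma reachable_change_in_A p x y q :
  A (p ++ x :: q) -> A (p ++ y :: q) -> R (p ++ x :: q) -> R (p ++ y :: q).
Proof.
have n_gt0 := ltnW (ltnW n_gt2).
move=> x_in y_in.
by apply: reachable_change; [apply: S_list_rot|apply: in_A_S_list..].
Qed.

Lemma root_bracelet_in_A : A root_bracelet.
Proof.
rewrite in_AE /= size_nseq all_nseq ltnSn orbT; apply/and3P; split; try lia.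
apply: asym_bracelet_cons; first by rewrite /= all_nseq; lia.
rewrite rev_cons rev_nseq; case: n n_gt2 => [|[|[|l]]] //= _.
by apply: ltxi_head; rewrite ltEnat /=; lia.
Qed.

(* Two changes lead to the root: the first [m] becomes [m.-1], then the other
   [m.-1] becomes [m]. *)
Lemma reachable_max_blocks j c :
  j < c -> A (0 :: nseq j m ++ m.-1 :: nseq c m) ->
  R (0 :: nseq j m ++ m.-1 :: nseq c m).
Proof.
move=> jc w_in; have := w_in; rewrite in_AE => /andP[/eqP /=].
rewrite size_cat /= !size_nseq => w_size _.
case: j jc w_in w_size => [|j] jc w_in w_size.
  suff -> : 0 :: nseq 0 m ++ m.-1 :: nseq c m = root_bracelet.
    exact: reachable_refl.
  by rewrite /root_bracelet -w_size.
have root_eq : root_bracelet = (0 :: m.-1 :: nseq j m) ++ m :: nseq c m.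
  rewrite /root_bracelet -w_size /=; congr [:: _, _ & _].
  by rewrite -[m :: nseq c m]/(nseq c.+1 m) -nseqD.
have mid_in : A ([:: 0] ++ m.-1 :: nseq j m ++ m.-1 :: nseq c m).
  apply: (in_A_change (x := m)) => //; first exact: leq_pred.
  apply: asym_bracelet_cons; first by rewrite /= all_cat /= !all_nseq; lia.
  rewrite /= rev_cons rev_cat rev_cons !rev_nseq; case: (c) jc => //= c' _.
  by apply: ltxi_head; rewrite ltEnat /=; lia.
apply: (@reachable_change_in_A [:: 0] m.-1) => //.
apply: (@reachable_change_in_A (0 :: m.-1 :: nseq j m) m); rewrite -?root_eq //.
  exact: root_bracelet_in_A.
exact: reachable_refl.
Qed.

Lemma reachable_zero_cons w : A (0 :: w) -> R (0 :: w).
Proof.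
pose codegree v := sumn [seq m - x | x <- v].
have [N] := ubnP (codegree w); elim: N w => // N IH w w_lt w_in.
have := w_in; rewrite in_AE => /and3P[_ /andP[_ w_le] asym_w].
have m_pred_gt0 : 0 < m.-1 by lia.
have [[j [c [jc ew]]]|[p [x [y [q [ew /andP[xy ym] asym_y]]]]]] :=
    asym_bracelet_raisable m_pred_gt0 w_le asym_w.
  by rewrite ew in w_in *; apply: reachable_max_blocks.
rewrite ew in w_in w_lt *.
have y_in : A ((0 :: p) ++ y :: q) := in_A_change (p := 0 :: p) w_in ym asym_y.
apply: (reachable_change_in_A (p := 0 :: p) y_in w_in); apply: IH y_in.
rewrite -ltnS; apply: leq_trans w_lt.
by rewrite /codegree !map_cat !sumn_cat /=; lia.
Qed.

Lemma reachable_S_list : {in S_list m.+1 n, forall w, R w}.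
Proof.
move=> w /S_listP[a a_in /mapP[i _ ->]]; apply: reachable_rot.
have := a_in; rewrite in_AE => /and3P[/eqP a_size _ asym_a].
case: a a_in a_size asym_a => [|[|h] v] a_in a_size asym_a.
- by move: n_gt2; rewrite -a_size.
- exact: reachable_zero_cons.
have zero_in : A (0 :: v).
  apply: (@in_A_change [::] h.+1) => //.
  exact: asym_bracelet_lower_head asym_a.
apply: (reachable_change_in_A (p := [::]) zero_in a_in).
exact: reachable_zero_cons.
Qed.

End Connectivity.

Theorem mainTheorem11 (n k : nat) (hn : 3 <= n) (hk : 3 <= k) :
  exists s : seq nat,
    [/\ all (fun x => x < k) s,
        size s = L k n,
        perm_eq (windows n s) (S_list k n)
      & orientable n s].
Proof.
case: k hk => // m m_gt1; have n_gt0 : 0 < n by lia.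
have [s s_windows] : exists s, perm_eq (windows n s) (S_list m.+1 n).
  apply: (@universal_cycle_exists n _ _ (root_bracelet n m)).
  - by move=> w /S_list_word[].
  - exact: S_list_uniq.
  - exact/in_A_S_list/root_bracelet_in_A.
  - exact: S_list_rot.
  - exact: reachable_S_list.
exists s; split=> //.
- apply: (all_windows n_gt0); apply/allP => w.
  by rewrite (perm_mem s_windows) => /S_list_word[].
- by rewrite -(size_windows n) (perm_size s_windows).
- exact: orientable_perm (S_list_uniq _ _) s_windows (@rev_notin_S_list _ _).
Qed.
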